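(* Let $k\in\mathbb{N}$, $k\ge1$, and let $i\in\{0,\pi,\pi/2\}$. Let $M_{k,i}=G/\Lambda_{k,i}$ be the compact Lorentzian solvmanifold with the metric induced by the bi-invariant metric $g$ of $G$. Then: (1) every null (lightlike) geodesic on $M_{k,i}$ is periodic; (2) on $M_{k,i}$ there are closed timelike geodesics, non-closed timelike geodesics, closed spacelike geodesics, and non-closed spacelike geodesics.
   Context: $G$ is the oscillator group: the manifold $\mathbb{R}^4$ with coordinates $(t,v,z)$, $v=(x,y)\in\mathbb{R}^2$, and product $$(t,v,z)\cdot(t',v',z')=\bigl(t+t',\,v+R(t)v',\,z+z'+\tfrac12 v^{T}JR(t)v'\bigr),$$ with $R(t)=\begin{pmatrix}\cos t&-\sin t\\ \sin t&\cos t\end{pmatrix}$ and $J=\begin{pmatrix}0&1\\-1&0\end{pmatrix}$. It carries the bi-invariant Lorentzian metric $g$ whose matrix in the basis $\partial_t,\partial_x,\partial_y,\partial_z$ at $(t,x,y,z)$ is $$\begin{pmatrix}0&\frac12y&-\frac12x&1\\ \frac12y&1&0&0\\-\frac12x&0&1&0\\1&0&0&0\end{pmatrix}.$$ The lattices $\Lambda_{k,i}<G$ are $$\Lambda_{k,0}=2\pi\mathbb{Z}\ltimes\Gamma_k,\quad \Lambda_{k,\pi}=\pi\mathbb{Z}\ltimes\Gamma_k,\quad \Lambda_{k,\pi/2}=\tfrac{\pi}{2}\mathbb{Z}\ltimes\Gamma_k,\qquad \Gamma_k=\mathbb{Z}\times\mathbb{Z}\times\tfrac1{2k}\mathbb{Z},$$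 i.e. the sets of $(t,x,y,z)$ with $t$ in $2\pi\mathbb{Z}$, $\pi\mathbb{Z}$, $\frac\pi2\mathbb{Z}$ respectively and $(x,y,z)\in\Gamma_k$. $M_{k,i}=G/\Lambda_{k,i}$ carries the metric for which the projection $G\to G/\Lambda_{k,i}$ is a local isometry. A (nonconstant) geodesic is null (lightlike), spacelike or timelike if its velocity $X$ satisfies $g(X,X)=0$, $>0$ or $<0$ respectively. Geodesics are defined on all of $\mathbb{R}$. A curve $\gamma:\mathbb{R}\to M_{k,i}$ is closed if $\gamma(t_0)=\gamma(t_1)$ for some $t_0\neq t_1$, and periodic if there is $T\ne0$ with $\gamma(t+T)=\gamma(t)$ for all $t\in\mathbb{R}$. *)

(* Defs.v *)
From mathcomp Require Import all_boot all_order all_algebra.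
From mathcomp Require Import all_classical all_reals all_analysis.

Set Implicit Arguments.
Unset Strict Implicit.
Unset Printing Implicit Defensive.

Import Order.TTheory GRing.Theory Num.Theory.
Import numFieldNormedType.Exports.

Local Open Scope classical_set_scope.
Local Open Scope ring_scope.

(** Points of the oscillator group are row vectors (t, x, y, z).  The group
    law is [osc_mul]; the additive structure of 'rV[R]_4 is only used for
    differential calculus in the global chart. *)

Section Group.
Context {R : realType}.

Definition osc (t : R) (v : 'cV[R]_2) (z : R) : 'rV[R]_4 :=
  \row_(i < 4) [:: t; v ord0 ord0; v ord_max ord0; z]`_i.

Definition osc_t (p : 'rV[R]_4) : R := p ord0 (@Ordinal 4 0 isT).
Definition osc_x (p : 'rV[R]_4) : R := p ord0 (@Ordinal 4 1 isT).
Definition osc_y (p : 'rV[R]_4) : R := p ord0 (@Ordinal 4 2 isT).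
Definition osc_z (p : 'rV[R]_4) : R := p ord0 (@Ordinal 4 3 isT).

Definition osc_v (p : 'rV[R]_4) : 'cV[R]_2 :=
  \col_(i < 2) [:: osc_x p; osc_y p]`_i.

Definition rot (t : R) : 'M[R]_2 :=
  \matrix_(i < 2, j < 2)
    (nth [::] [:: [:: cos t; - sin t]; [:: sin t; cos t]] i)`_j.

Definition J2 : 'M[R]_2 :=
  \matrix_(i < 2, j < 2) (nth [::] [:: [:: 0; 1]; [:: -1; 0]] i)`_j.

Definition osc_mul (p q : 'rV[R]_4) : 'rV[R]_4 :=
  let v := osc_v p in
  let v' := osc_v q in
  osc (osc_t p + osc_t q)
      (v + rot (osc_t p) *m v')
      (osc_z p + osc_z q
       + 2^-1 * (v^T *m J2 *m rot (osc_t p) *m v') ord0 ord0).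

End Group.

Section Metric.
Context {R : realType}.

Definition osc_metric (p : 'rV[R]_4) : 'M[R]_4 :=
  \matrix_(i < 4, j < 4)
    (nth [::]
       [:: [:: 0;               2^-1 * osc_y p; - (2^-1 * osc_x p); 1];
           [:: 2^-1 * osc_y p;     1;              0;                  0];
           [:: - (2^-1 * osc_x p); 0;              1;                  0];
           [:: 1;                  0;              0;                  0]] i)`_j.

Definition metric_at (p X Y : 'rV[R]_4) : R :=
  (X *m osc_metric p *m Y^T) ord0 ord0.

Definition pderiv (i : 'I_4) (f : 'rV[R]_4 -> R) (p : 'rV[R]_4) : R :=
  'D_(delta_mx ord0 i) f p.

(* Christoffel symbol Gamma^k_ij of the Levi-Civita connection *)
Definition christoffel (k i j : 'I_4) (p : 'rV[R]_4) : R :=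
  2^-1 * \sum_(l < 4) invmx (osc_metric p) k l *
    (pderiv i (fun q => osc_metric q j l) p
     + pderiv j (fun q => osc_metric q i l) p
     - pderiv l (fun q => osc_metric q i j) p).

Definition geodesic_at (a : R -> 'rV[R]_4) (s : R) : Prop :=
  [/\ derivable a s 1, derivable (derive1 a) s 1 &
      forall k : 'I_4,
        derive1 (derive1 a) s ord0 k
        + \sum_(i < 4) \sum_(j < 4)
            christoffel k i j (a s) * derive1 a s ord0 i * derive1 a s ord0 j = 0].

End Metric.

Section Lattices.
Context (R : realType).

Inductive lattice_index := Idx_0 | Idx_pi | Idx_pi2.

(* the generator of the t-component of the lattice; it is 2 pi for index 0 *)
Definition lattice_step (i : lattice_index) : R :=
  match i with
  | Idx_0 => 2 * pi
  | Idx_pi => pi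
  | Idx_pi2 => pi / 2
  end.

Definition Gamma (k : nat) : set (R * R * R) :=
  [set w | exists a b c : int,
     w = (a%:~R, b%:~R, c%:~R / (2 * k%:R))].

Definition Lambda (k : nat) (i : lattice_index) : set 'rV[R]_4 :=
  [set p | (exists m : int, osc_t p = m%:~R * lattice_step i) /\
           Gamma k (osc_x p, osc_y p, osc_z p)].

Definition lcoset (p : 'rV[R]_4) (L : set 'rV[R]_4) : set 'rV[R]_4 :=
  osc_mul p @` L.

(* the set of left cosets G / Lambda, as a type *)
Definition solvmanifold (k : nat) (i : lattice_index) : Type :=
  set_type (range (fun p => lcoset p (Lambda k i))).

Definition proj (k : nat) (i : lattice_index) (p : 'rV[R]_4) :
    solvmanifold k i :=
  exist _ (lcoset p (Lambda k i)) (mem_set (imageT _ p)).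

End Lattices.

Section QuotientGeodesics.
Context {R : realType} {k : nat} {i : lattice_index}.
Implicit Types (c : R -> solvmanifold R k i) (s : R).

(** As the projection is a local isometry (and a covering), the geometry of
    the quotient is computed on local lifts: a curve is a geodesic if around
    every parameter it is the projection of a geodesic of G, and the square
    of its velocity is that of the velocity of such a lift. *)

Definition geodesic_lift c s (a : R -> 'rV[R]_4) : Prop :=
  \forall u \near s, c u = proj k i (a u) /\ geodesic_at a u.

Definition geodesic c : Prop :=
  forall s, exists a, geodesic_lift c s a.

Definition nonconstant c : Prop := exists s u, c s <> c u.

Definition velocity_sq c s (P : R -> Prop) : Prop :=
  exists2 a, geodesic_lift c s a & P (metric_at (a s) (derive1 a s) (derive1 a s)).

Definition null_geodesic c : Prop :=
  [/\ geodesic c, nonconstant c &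
      forall s, velocity_sq c s (fun q => q = 0)].

Definition spacelike_geodesic c : Prop :=
  [/\ geodesic c, nonconstant c &
      forall s, velocity_sq c s (fun q => 0 < q)].

Definition timelike_geodesic c : Prop :=
  [/\ geodesic c, nonconstant c &
      forall s, velocity_sq c s (fun q => q < 0)].

Definition closed_curve c : Prop := exists t0 t1, t0 <> t1 /\ c t0 = c t1.

Definition periodic_curve c : Prop :=
  exists T : R, T <> 0 /\ forall t, c (t + T) = c t.

End QuotientGeodesics.

(* Main.v *)
(** Left translation turns the geodesic equation of the bi-invariant metric into
    [A^-1 A' = xi] with [xi] constant, so the geodesics of the group are the
    translated one-parameter subgroups, and [g(A', A')] depends on [xi] only.
    For a null [xi] with nonzero t-component [tau], the one-parameter subgroup
    reaches the central lattice element (2 pi, 0, 0, 0) at time [2 pi / tau]: the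
    z-drift over one turn is a multiple of [g(xi, xi)].  For [tau = 0], nullity
    leaves only a line in the central z-direction.

    A geodesic of the quotient is only given by local lifts.  Two lifts of the
    same curve differ by a continuous, hence locally constant, lattice element,
    and right translations preserve [A^-1 A' = const]; so the global flow that
    extends one local lift projects to the whole geodesic.

    The examples of (2) are the projections of the lines [s (1, 0, 0, K)], with
    squared velocity [2 K]: [K = n / (2 pi)] gives closed ones, and a nonzero
    integer [K] gives non-closed ones because [pi] is irrational. *)
Require Import Defs.
From mathcomp Require Import all_boot all_order all_algebra.
From mathcomp Require Import all_classical all_reals all_analysis.
From mathcomp Require Import ring lra.

Set Implicit Arguments.
Unset Strict Implicit.
Unset Printing Implicit Defensive.

Import Order.TTheory GRing.Theory Num.Theory.
Import numFieldNormedType.Exports.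

Local Open Scope classical_set_scope.
Local Open Scope ring_scope.

Require Import Defs.
From mathcomp Require Import all_boot all_order all_algebra.
From mathcomp Require Import all_classical all_reals all_analysis.
From mathcomp Require Import ring lra.

Set Implicit Arguments.
Unset Strict Implicit.
Unset Printing Implicit Defensive.

Import Order.TTheory GRing.Theory Num.Theory.
Import numFieldNormedType.Exports.

Local Open Scope classical_set_scope.
Local Open Scope ring_scope.

(** * The group law in coordinates *)

Section Coordinates.
Context {R : realType}.
Implicit Types (p q r : 'rV[R]_4).

Lemma rV4P p q :
  osc_t p = osc_t q -> osc_x p = osc_x q -> osc_y p = osc_y q ->
  osc_z p = osc_z q -> p = q.
Proof.
move=> et ex ey ez; apply/rowP => -[[|[|[|[|//]]]] i4] /=.
- by move: et; rewrite /osc_t (bool_irrelevance i4 isT).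
- by move: ex; rewrite /osc_x (bool_irrelevance i4 isT).
- by move: ey; rewrite /osc_y (bool_irrelevance i4 isT).
- by move: ez; rewrite /osc_z (bool_irrelevance i4 isT).
Qed.

Definition vec4 (t x y z : R) : 'rV[R]_4 := \row_i [:: t; x; y; z]`_i.

Lemma vec4_t t x y z : osc_t (vec4 t x y z) = t.
Proof. by rewrite /osc_t mxE. Qed.

Lemma vec4_x t x y z : osc_x (vec4 t x y z) = x.
Proof. by rewrite /osc_x mxE. Qed.

Lemma vec4_y t x y z : osc_y (vec4 t x y z) = y.
Proof. by rewrite /osc_y mxE. Qed.

Lemma vec4_z t x y z : osc_z (vec4 t x y z) = z.
Proof. by rewrite /osc_z mxE. Qed.

Definition vec4E := (vec4_t, vec4_x, vec4_y, vec4_z).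

Lemma vec4_eta p : p = vec4 (osc_t p) (osc_x p) (osc_y p) (osc_z p).
Proof. by apply: rV4P; rewrite vec4E. Qed.

Lemma osc_mul_t p q : osc_t (osc_mul p q) = osc_t p + osc_t q.
Proof. by rewrite /osc_mul [LHS]/osc_t mxE. Qed.

Lemma osc_mul_x p q : osc_x (osc_mul p q) =
  osc_x p + (cos (osc_t p) * osc_x q - sin (osc_t p) * osc_y q).
Proof.
rewrite /osc_mul [LHS]/osc_x mxE /=.
by rewrite !(mxE, big_ord_recl, big_ord0) /= addr0 mulNr.
Qed.

Lemma osc_mul_y p q : osc_y (osc_mul p q) =
  osc_y p + (sin (osc_t p) * osc_x q + cos (osc_t p) * osc_y q).
Proof.
rewrite /osc_mul [LHS]/osc_y mxE /=.
by rewrite !(mxE, big_ord_recl, big_ord0) /= addr0.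
Qed.

Lemma osc_mul_z p q : osc_z (osc_mul p q) =
  osc_z p + osc_z q + 2^-1 *
    (osc_x p * (sin (osc_t p) * osc_x q + cos (osc_t p) * osc_y q)
     - osc_y p * (cos (osc_t p) * osc_x q - sin (osc_t p) * osc_y q)).
Proof.
rewrite /osc_mul [LHS]/osc_z mxE /=.
by rewrite !(mxE, big_ord_recl, big_ord0) /=; field.
Qed.

Definition osc_mulE := (osc_mul_t, osc_mul_x, osc_mul_y, osc_mul_z).

Lemma osc_mulA p q r : osc_mul p (osc_mul q r) = osc_mul (osc_mul p q) r.
Proof.
apply: rV4P; rewrite !osc_mulE ?sinD ?cosD; try ring.
have h := sin2cos2 (osc_t p).
by field: h.
Qed.

End Coordinates.

(** * The lattices are closed under the product; equality of cosets *)

Section LatticeTranslations.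
Context {R : realType}.
Context (k : nat) (i : lattice_index).
Context (hk : (1 <= k)%N).
Implicit Types (p q r : 'rV[R]_4).

(** Quarter turns have integer rotation matrices. This is why the t-components of the lattice map
    the integer points of the plane to integer points. *)
Lemma cos_sin_pihalf_int (m : int) : exists a b : int,
  cos (m%:~R * (pi / 2)) = a%:~R :> R /\ sin (m%:~R * (pi / 2)) = b%:~R :> R.
Proof.
have nat_case (n : nat) : exists a b : int,
    cos (n%:R * (pi / 2)) = a%:~R :> R /\ sin (n%:R * (pi / 2)) = b%:~R :> R.
  elim: n => [|n [a [b [ca sb]]]].
    by exists 1, 0; rewrite mul0r cos0 sin0.
  exists (- b), a; rewrite -natr1 mulrDl mul1r cosDpihalf sinDpihalf ca sb.
  by rewrite rmorphN.
case: m => n; first exact: nat_case.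
have [a [b [ca sb]]] := nat_case n.+1.
by exists a, (- b); rewrite NegzE !rmorphN /= mulNr cosN sinN ca sb.
Qed.

Lemma lattice_step_pihalf : exists n : int,
  lattice_step R i = n%:~R * (pi / 2).
Proof. by case: i; [exists 4|exists 2|exists 1] => /=; field. Qed.

Lemma Lambda_mul p q :
  Lambda k i p -> Lambda k i q -> Lambda k i (osc_mul p q).
Proof.
move=> [[m tp] [a [b [c [xp yp zp]]]]] [[n tq] [a' [b' [c' [xq yq zq]]]]].
have [l stepE] := lattice_step_pihalf.
have [C [S [cosp sinp]]] := cos_sin_pihalf_int (m * l).
have tpE : osc_t p = (m * l)%:~R * (pi / 2) by rewrite tp stepE intrM mulrA.
split; first by exists (m + n); rewrite osc_mulE tp tq -mulrDl -intrD.
(* The half-integer produced by the z-cocycle lies in the z-lattice because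
   [n / 2 = (k * n) / (2 * k)]; this is the source of the factor [k%:Z]. *)
exists (a + (C * a' - S * b')), (b + (S * a' + C * b')),
  (c + c' + k%:Z * (a * (S * a' + C * b') - b * (C * a' - S * b'))).
rewrite !osc_mulE tpE cosp sinp xp yp zp xq yq zq.
rewrite !(intrD, intrB, intrM, rmorphN) -?pmulrn /=.
by congr (_, _, _); field; rewrite ?pnatr_eq0 -?lt0n.
Qed.

Lemma Lambda_tz (t : R) (c : int) :
  (exists m : int, t = m%:~R * lattice_step R i) ->
  Lambda k i (vec4 t 0 0 c%:~R).
Proof.
move=> tE; split; rewrite !vec4E //.
exists 0, 0, (c * (2 * k%:Z)).
congr (_, _, _); rewrite !intrM -?pmulrn /=.
by field; rewrite ?pnatr_eq0 -?lt0n.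
Qed.

Lemma osc_mulp0 p : osc_mul p 0 = p.
Proof.
apply: rV4P; rewrite !osc_mulE /osc_t /osc_x /osc_y /osc_z !mxE; try ring.
Qed.

Lemma Lambda0 : Lambda k i (0 : 'rV[R]_4).
Proof.
split; first by exists 0; rewrite mul0r /osc_t mxE.
by exists 0, 0, 0; rewrite /osc_x /osc_y /osc_z !mxE mul0r.
Qed.

Lemma proj_eqP p q : Defs.proj k i p = Defs.proj k i q ->
  exists2 l, Lambda k i l & p = osc_mul q l.
Proof.
move=> pq;
have {}pq : lcoset p (Lambda k i) = lcoset q (Lambda k i) := congr1 sval pq.
have : lcoset p (Lambda k i) p by exists 0; [exact: Lambda0|exact: osc_mulp0].
by rewrite pq => -[l Ll <-]; exists l.
Qed.

(** The second lattice element [l'] stands in for the inverse of [l], so the two inclusions of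
    cosets follow from closure under products alone. *)
Lemma eq_proj p q l l' : Lambda k i l -> Lambda k i l' ->
  p = osc_mul q l -> q = osc_mul p l' -> Defs.proj k i p = Defs.proj k i q.
Proof.
move=> Ll Ll' pE qE; apply: val_inj => /=.
rewrite eqEsubset; split=> _ [m Lm <-].
  by exists (osc_mul l m); [exact: Lambda_mul|rewrite osc_mulA -pE].
by exists (osc_mul l' m); [exact: Lambda_mul|rewrite osc_mulA -qE].
Qed.

End LatticeTranslations.

(** * Curves with prescribed left-invariant velocity *)

Section LeftVelocity.
Context {R : realType}.
Implicit Types (A B : R -> 'rV[R]_4) (xi l : 'rV[R]_4) (u s : R).

(* A(u)^-1 A'(u) = xi *)
Definition left_velocity A xi u : Prop :=
  let t := osc_t (A u) in
  let x' := cos t * osc_x xi - sin t * osc_y xi in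
  let y' := sin t * osc_x xi + cos t * osc_y xi in
  [/\ is_derive u (1 : R) (osc_t \o A) (osc_t xi),
      is_derive u (1 : R) (osc_x \o A) x',
      is_derive u (1 : R) (osc_y \o A) y' &
      is_derive u (1 : R) (osc_z \o A)
        (osc_z xi + 2^-1 * (osc_x (A u) * y' - osc_y (A u) * x'))].

(* Ad(l^-1) xi *)
Definition osc_AdV l xi : 'rV[R]_4 :=
  let a := osc_x xi - osc_t xi * osc_y l in
  let b := osc_y xi + osc_t xi * osc_x l in
  vec4 (osc_t xi) (cos (osc_t l) * a + sin (osc_t l) * b)
    (cos (osc_t l) * b - sin (osc_t l) * a)
    (osc_z xi + (osc_x xi * osc_y l - osc_y xi * osc_x l)
     - 2^-1 * osc_t xi * (osc_x l ^+ 2 + osc_y l ^+ 2)).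

(** For constant [l], the left velocity of [A l] is [l^-1 (A^-1 A') l]: right translation changes
    the velocity only by a fixed adjoint map. *)
Lemma left_velocity_mulr A xi l u : left_velocity A xi u ->
  left_velocity (fun s => osc_mul (A s) l) (osc_AdV l xi) u.
Proof.
move=> [dt dx dy dz]; rewrite /left_velocity /osc_AdV.
set a := osc_x xi - _; set b := osc_y xi + _; rewrite !osc_mulE !vec4E.
have h := sin2cos2 (osc_t l).
have h' := sin2cos2 (osc_t (A u)).
split.
- rewrite (_ : _ \o _ = fun s => (osc_t \o A) s + osc_t l); last first.
    by apply: funext => s /=; rewrite osc_mulE.
  by apply: is_derive_eq; rewrite addr0.
- rewrite (_ : _ \o _ = fun s => (osc_x \o A) s +
    (cos ((osc_t \o A) s) * osc_x l - sin ((osc_t \o A) s) * osc_y l));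
    last first.
    by apply: funext => s /=; rewrite osc_mulE.
  by apply: is_derive_eq; rewrite sinD cosD /GRing.scale /= /a /b; field: h.
- rewrite (_ : _ \o _ = fun s => (osc_y \o A) s +
    (sin ((osc_t \o A) s) * osc_x l + cos ((osc_t \o A) s) * osc_y l));
    last first.
    by apply: funext => s /=; rewrite osc_mulE.
  by apply: is_derive_eq; rewrite sinD cosD /GRing.scale /= /a /b; field: h.
- rewrite (_ : _ \o _ = fun s => (osc_z \o A) s + osc_z l + 2^-1 *
    ((osc_x \o A) s *
      (sin ((osc_t \o A) s) * osc_x l + cos ((osc_t \o A) s) * osc_y l)
    - (osc_y \o A) s *
      (cos ((osc_t \o A) s) * osc_x l - sin ((osc_t \o A) s) * osc_y l)));
    last first.
    by apply: funext => s /=; rewrite osc_mulE.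
  apply: is_derive_eq; rewrite sinD cosD /GRing.scale /= /a /b.
  by field: h h'.
Qed.

End LeftVelocity.

(** * Uniqueness of flows, and local constancy of discrete-valued functions *)

Section Uniqueness.
Context {R : realType}.
Implicit Types (A B : R -> 'rV[R]_4) (xi l p q : 'rV[R]_4) (u s e : R).

(** The difference has zero derivative on the ball, and the mean value theorem is applied on the
    segment between [s] and [u], on either side of [s]. *)
Lemma derive_eq_ball (f g df : R -> R) s e :
  (forall u, `|u - s| < e -> is_derive u 1 f (df u)) ->
  (forall u, `|u - s| < e -> is_derive u 1 g (df u)) ->
  f s = g s -> forall u, `|u - s| < e -> f u = g u.
Proof.
move=> fd gd fgs u us.
pose h v := f v - g v.
have hd v : `|v - s| < e -> is_derive v 1 h 0.
  move=> ve; have := fd _ ve; have := gd _ ve => gv fv.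
  by apply: is_derive_eq; rewrite subrr.
have hc v : `|v - s| < e -> h @ v --> h v.
  by move=> /hd ?; apply/differentiable_continuous/derivable1_diffP.
suff : h u = h s by rewrite /h fgs subrr => /subr0_eq.
case: (leP s u) => [su|/ltW su].
- have sub v : v \in `[s, u] -> `|v - s| < e.
    rewrite in_itv /= => /andP[sv vu]; apply: le_lt_trans us.
    by rewrite !ger0_norm ?subr_ge0// lerB.
  have [v vI||c _] := @MVT_segment _ h (cst 0) _ _ su.
  + by apply/hd/sub; apply: subset_itv_oo_cc vI.
  + by apply: continuous_in_subspaceT => v; rewrite inE => /sub/hc.
  + by rewrite mul0r => /subr0_eq.
- have sub v : v \in `[u, s] -> `|v - s| < e.
    rewrite in_itv /= => /andP[uv vs]; apply: le_lt_trans us.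
    by rewrite !ler0_norm ?subr_le0// lerN2 lerB.
  have [v vI||c _] := @MVT_segment _ h (cst 0) _ _ su.
  + by apply/hd/sub; apply: subset_itv_oo_cc vI.
  + by apply: continuous_in_subspaceT => v; rewrite inE => /sub/hc.
  + by rewrite mul0r => /subr0_eq.
Qed.

(** The system is triangular: t has constant derivative, the derivatives of x and y depend on t
    only, and that of z on t, x, y. Hence four scalar comparisons in this order suffice, with no
    general theorem on differential equations. *)
Lemma left_velocity_unique A B xi s e :
  (forall u, `|u - s| < e -> left_velocity A xi u) ->
  (forall u, `|u - s| < e -> left_velocity B xi u) ->
  A s = B s -> forall u, `|u - s| < e -> A u = B u.
Proof.
move=> dA dB ABs.
have et u : `|u - s| < e -> osc_t (A u) = osc_t (B u).
  apply: (@derive_eq_ball (osc_t \o A) (osc_t \o B) (cst (osc_t xi))) => /=.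
  - by move=> v /dA [].
  - by move=> v /dB [].
  - by rewrite ABs.
have ex u : `|u - s| < e -> osc_x (A u) = osc_x (B u).
  apply: (@derive_eq_ball (osc_x \o A) (osc_x \o B)
    (fun u => cos (osc_t (A u)) * osc_x xi - sin (osc_t (A u)) * osc_y xi)) => /=.
  - by move=> v /dA [].
  - by move=> v ve; rewrite et//; case: (dB _ ve).
  - by rewrite ABs.
have ey u : `|u - s| < e -> osc_y (A u) = osc_y (B u).
  apply: (@derive_eq_ball (osc_y \o A) (osc_y \o B)
    (fun u => sin (osc_t (A u)) * osc_x xi + cos (osc_t (A u)) * osc_y xi)) => /=.
  - by move=> v /dA [].
  - by move=> v ve; rewrite et//; case: (dB _ ve).
  - by rewrite ABs.
have ez u : `|u - s| < e -> osc_z (A u) = osc_z (B u).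
  apply: (@derive_eq_ball (osc_z \o A) (osc_z \o B) (fun u => osc_z xi + 2^-1 *
    (osc_x (A u) *
       (sin (osc_t (A u)) * osc_x xi + cos (osc_t (A u)) * osc_y xi) -
     osc_y (A u) *
       (cos (osc_t (A u)) * osc_x xi - sin (osc_t (A u)) * osc_y xi)))) => /=.
  - by move=> v /dA [].
  - by move=> v ve; rewrite et// ex// ey//; case: (dB _ ve).
  - by rewrite ABs.
by move=> u us; apply: rV4P; [exact: et|exact: ex|exact: ey|exact: ez].
Qed.

Lemma rotation_inj (t x y x' y' : R) :
  cos t * x - sin t * y = cos t * x' - sin t * y' ->
  sin t * x + cos t * y = sin t * x' + cos t * y' -> x = x' /\ y = y'.
Proof.
pose U v w := cos t * v - sin t * w; pose V v w := sin t * v + cos t * w.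
rewrite -/(U x y) -/(U x' y') -/(V x y) -/(V x' y') => eU eV.
have h := sin2cos2 t.
have xE v w : v = cos t * U v w + sin t * V v w by rewrite /U /V; ring: h.
have yE v w : w = cos t * V v w - sin t * U v w by rewrite /U /V; ring: h.
by split; [rewrite (xE x y) (xE x' y')|rewrite (yE x y) (yE x' y')]; rewrite eU eV.
Qed.

(** Curves that agree near [s] have equal coordinate derivatives there, and [xi] is recovered from
    these by undoing the rotation and cancelling the common cocycle term in z. *)
Lemma left_velocity_inj A B xi eta s :
  left_velocity A xi s -> left_velocity B eta s ->
  (\forall u \near s, A u = B u) -> xi = eta.
Proof.
move=> [At Ax Ay Az] [Bt Bx By Bz] AB; have ABs := nbhs_singleton AB.
have eqd (c : 'rV[R]_4 -> R) (a b : R) :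
    is_derive s 1 (c \o A) a -> is_derive s 1 (c \o B) b -> a = b.
  move=> da db; rewrite -(@derive_val _ _ _ _ _ _ _ da).
  rewrite -(@derive_val _ _ _ _ _ _ _ db).
  apply: near_eq_derive.
  by near=> u => /=; congr (c _); near: u.
have et := eqd _ _ _ At Bt.
have ex0 := eqd _ _ _ Ax Bx.
have ey0 := eqd _ _ _ Ay By.
have ez := eqd _ _ _ Az Bz.
rewrite -ABs in ex0 ey0 ez.
have [ex ey] := rotation_inj ex0 ey0.
by apply: rV4P => //; move: ez; rewrite ex0 ey0 => /addIr.
Unshelve. all: by end_near. Qed.

(** Distinct multiples of [r] are at distance at least [r], while continuity keeps [f u] closer than
    that to [f s]. *)
Lemma near_constant_discrete (f : R -> R) (r : R) s : 0 < r ->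
  derivable f s 1 -> (\forall u \near s, exists m : int, f u = m%:~R * r) ->
  \forall u \near s, f u = f s.
Proof.
move=> r0 df fZ; have [m fs] := nbhs_singleton fZ.
have fc : f @ s --> f s by apply/differentiable_continuous/derivable1_diffP.
move/cvgrPdist_lt : fc => /(_ _ r0) fc.
near=> u.
have [n fu] : exists n : int, f u = n%:~R * r by near: u.
have : `|f s - f u| < r by near: u.
rewrite fs fu -mulrBl normrM (gtr0_norm r0) -[ltRHS]mul1r ltr_pM2r//.
rewrite -intrB -intr_norm ltrz1 -[1]add0r ltzD1 normr_le0 subr_eq0.
by move=> /eqP ->.
Unshelve. all: by end_near. Qed.

(** This is [p^-1 q], written out without a separate inverse. *)
Definition osc_ldiv p q : 'rV[R]_4 :=
  let a := osc_x q - osc_x p in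
  let b := osc_y q - osc_y p in
  vec4 (osc_t q - osc_t p) (cos (osc_t p) * a + sin (osc_t p) * b)
    (cos (osc_t p) * b - sin (osc_t p) * a)
    (osc_z q - osc_z p - 2^-1 * (osc_x p * b - osc_y p * a)).

Lemma osc_mulK p l : osc_ldiv p (osc_mul p l) = l.
Proof.
rewrite /osc_ldiv; set a := osc_x _ - _; set b := osc_y _ - _.
have h := sin2cos2 (osc_t p).
apply: rV4P; rewrite vec4E /a /b !osc_mulE.
- ring.
- by ring: h.
- by ring: h.
- by field: h.
Qed.

End Uniqueness.

(** * Flows with the same projection near one parameter have the same projection everywhere *)

Section Rigidity.
Context {R : realType} (k : nat) (i : lattice_index) (hk : (1 <= k)%N).
Implicit Types (A B : R -> 'rV[R]_4) (xi eta l p q : 'rV[R]_4) (s : R).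

Lemma osc_ldiv_derivable A B xi eta s :
  left_velocity A xi s -> left_velocity B eta s ->
  let F u := osc_ldiv (B u) (A u) in
  [/\ derivable (osc_t \o F) s 1, derivable (osc_x \o F) s 1,
      derivable (osc_y \o F) s 1 & derivable (osc_z \o F) s 1].
Proof.
move=> [At Ax Ay Az] [Bt Bx By Bz] F.
pose a u := (osc_x \o A) u - (osc_x \o B) u.
pose b u := (osc_y \o A) u - (osc_y \o B) u.
have [eT eX eY eZ] : [/\ osc_t \o F = fun u => (osc_t \o A) u - (osc_t \o B) u,
  osc_x \o F = fun u => cos ((osc_t \o B) u) * a u + sin ((osc_t \o B) u) * b u,
  osc_y \o F = fun u => cos ((osc_t \o B) u) * b u - sin ((osc_t \o B) u) * a u &
  osc_z \o F = fun u => (osc_z \o A) u - (osc_z \o B) u -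
     2^-1 * ((osc_x \o B) u * b u - (osc_y \o B) u * a u)].
  by split; apply: funext => u;
    rewrite /= /F /osc_ldiv /osc_t /osc_x /osc_y /osc_z !mxE.
rewrite eT eX eY eZ /a /b.
by split; apply: ex_derive.
Qed.

(** The curve [B^-1 A] is differentiable at [s] and takes lattice values near [s]. Each of its
    coordinates is then discrete, with mesh [lattice_step], 1, 1 and [1 / (2 k)], hence locally
    constant. *)
Lemma proj_eq_near_translate A B xi eta s :
  left_velocity A xi s -> left_velocity B eta s ->
  (\forall u \near s, Defs.proj k i (A u) = Defs.proj k i (B u)) ->
  exists2 l, Lambda k i l & \forall u \near s, A u = osc_mul (B u) l.
Proof.
move=> dA dB AB.
have [dt dx dy dz] := osc_ldiv_derivable dA dB.
set F := fun u => osc_ldiv (B u) (A u) in dt dx dy dz.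
have FP : \forall u \near s, Lambda k i (F u) /\ A u = osc_mul (B u) (F u).
  near=> u.
  have [l Ll E] : exists2 l, Lambda k i l & A u = osc_mul (B u) l.
    by apply: proj_eqP; near: u.
  by rewrite /F E osc_mulK.
have step0 : 0 < lattice_step R i.
  by case: (i); rewrite /= ?mulr_gt0 ?divr_gt0 ?pi_gt0.
have k0 : 0 < (2 * k%:R)^-1 :> R by rewrite invr_gt0 mulr_gt0// ltr0n.
have ct : \forall u \near s, osc_t (F u) = osc_t (F s).
  apply: (near_constant_discrete step0 dt).
  by apply: filterS FP => u [[]].
have cx : \forall u \near s, osc_x (F u) = osc_x (F s).
  apply: (near_constant_discrete ltr01 dx).
  by apply: filterS FP => u [[_ [a [b [c [E _ _]]]]] _];
    exists a; rewrite mulr1.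
have cy : \forall u \near s, osc_y (F u) = osc_y (F s).
  apply: (near_constant_discrete ltr01 dy).
  by apply: filterS FP => u [[_ [a [b [c [_ E _]]]]] _];
    exists b; rewrite mulr1.
have cz : \forall u \near s, osc_z (F u) = osc_z (F s).
  apply: (near_constant_discrete k0 dz).
  by apply: filterS FP => u [[_ [a [b [c [_ _ E]]]]] _]; exists c.
exists (F s); first by have [] := nbhs_singleton FP.
near=> u.
have [_ {1}->] : Lambda k i (F u) /\ A u = osc_mul (B u) (F u) by near: u.
by congr osc_mul; apply: rV4P; near: u.
Unshelve. all: by end_near. Qed.

Lemma flow_translate A B xi eta s :
  (forall u, left_velocity A xi u) -> (forall u, left_velocity B eta u) ->
  (\forall u \near s, Defs.proj k i (A u) = Defs.proj k i (B u)) ->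
  exists2 l, Lambda k i l & forall u, A u = osc_mul (B u) l.
Proof.
move=> dA dB AB.
have [l Ll ABl] := proj_eq_near_translate (dA s) (dB s) AB.
exists l => // u.
(* Both [A] and [B l] are global flows. Agreement near [s] forces their velocities to coincide, and
   uniqueness then spreads it to a ball around [s] large enough to contain [u]. *)
have dBl v := left_velocity_mulr l (dB v).
have xiE := left_velocity_inj (dA s) (dBl s) ABl.
apply: (@left_velocity_unique _ _ (fun u => osc_mul (B u) l) xi s
  (`|u - s| + 1)).
- by move=> v _; exact: dA.
- by move=> v _; rewrite xiE.
- exact: nbhs_singleton ABl.
- by rewrite ltrDl.
Qed.

Lemma proj_flow_rigid A B xi eta s :
  (forall u, left_velocity A xi u) -> (forall u, left_velocity B eta u) ->
  (\forall u \near s, Defs.proj k i (A u) = Defs.proj k i (B u)) ->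
  forall u, Defs.proj k i (A u) = Defs.proj k i (B u).
Proof.
move=> dA dB AB u.
have [l Ll ABl] := flow_translate dA dB AB.
(* Exchanging the two flows supplies the lattice element of the opposite direction that [eq_proj]
   asks for. *)
have [l' Ll' BAl] : exists2 l, Lambda k i l & forall u, B u = osc_mul (A u) l.
  by apply: (flow_translate dB dA (s := s)); apply: filterS AB => v ->.
exact: eq_proj Ll Ll' (ABl u) (BAl u).
Qed.

End Rigidity.

(** * From a local lift to the whole curve *)

Section Continuation.
Context {R : realType} (k : nat) (i : lattice_index) (hk : (1 <= k)%N).
Implicit Types (A : R -> 'rV[R]_4) (xi : 'rV[R]_4) (s : R).

(** By connectedness of the line: the parameters near which [c] is the projection of [A] form a
    nonempty open set, and rigidity makes it closed. *)
Lemma flow_continuation (c : R -> solvmanifold R k i) A xi s :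
  (forall u : R, exists B eta, (forall v, left_velocity B eta v) /\
     \forall v \near u, c v = Defs.proj k i (B v)) ->
  (forall u, left_velocity A xi u) ->
  (\forall u \near s, c u = Defs.proj k i (A u)) ->
  forall u, c u = Defs.proj k i (A u).
Proof.
move=> c_flow dA cA.
pose U := [set u : R | \forall v \near u, c v = Defs.proj k i (A v)].
suff UT : U = setT.
  by move=> u; have : U u by [rewrite UT]; exact: nbhs_singleton.
have cT : connected [set: R] by exact/connected_intervalP.
apply: cT; first by exists s.
- exists U; [exact: (open_interior [set v | c v = Defs.proj k i (A v)])|].
  by rewrite setTI.
- exists U; last by rewrite setTI.
  rewrite closedE => u /= Uu.
  have [B [eta [dB cB]]] := c_flow u.
  (* At a limit point [u] of [U], some [w] in [U] lies where the flow [B] attached to [u] still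
     represents [c]. There [A] and [B] project alike, hence everywhere, in particular near [u]. *)
  have [w [Uw cBw]] : exists w,
      U w /\ \forall v \near w, c v = Defs.proj k i (B v).
    apply: contrapT => nw; apply: Uu.
    apply: filterS (nbhs_interior cB) => w cBw Uw.
    by apply: nw; exists w.
  have AB : forall v, Defs.proj k i (A v) = Defs.proj k i (B v).
    apply: (proj_flow_rigid hk dA dB (s := w)); near=> v.
    transitivity (c v); first by symmetry; near: v.
    by near: v.
  by apply: filterS cB => v ->; rewrite AB.
Unshelve. all: by end_near. Qed.

End Continuation.

(** * The Christoffel symbols and the explicit geodesic equation *)

Section GeodesicEquation.
Context {R : realType}.
Implicit Types (a : R -> 'rV[R]_4) (p X Z : 'rV[R]_4) (s : R).

(** The metric is affine in the point; this is its linear part, so the derivative in direction [v]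
    at every point. *)
Definition dmetric (v : 'rV[R]_4) : 'M[R]_4 :=
  \matrix_(i < 4, j < 4)
    (nth [::]
       [:: [:: 0; 2^-1 * osc_y v; - (2^-1 * osc_x v); 0];
           [:: 2^-1 * osc_y v; 0; 0; 0];
           [:: - (2^-1 * osc_x v); 0; 0; 0];
           [:: 0; 0; 0; 0]] i)`_j.

Lemma pderiv_metric (i j l : 'I_4) p :
  pderiv i (fun q => osc_metric q j l) p = dmetric (delta_mx ord0 i) j l.
Proof.
set v := delta_mx ord0 i.
have aff (h : R) :
    osc_metric (h *: v + p) j l = osc_metric p j l + h * dmetric v j l.
  rewrite !mxE; move: j l => [[|[|[|[|//]]]] ?] [[|[|[|[|//]]]] ?];
  by rewrite /= /osc_x /osc_y ?mxE; ring.
apply/cvg_lim => //=; apply: cvg_near_cst; near=> h.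
rewrite /= aff addrC addKr /GRing.scale /= mulKf//; near: h.
exact: nbhs_dnbhs_neq.
Unshelve. all: by end_near. Qed.

Lemma osc_metric_unit p : osc_metric p \in unitmx.
Proof.
pose x := 2^-1 * osc_x p; pose y := 2^-1 * osc_y p.
(* The explicit inverse of the metric. *)
pose g' : 'M[R]_4 := \matrix_(i < 4, j < 4)
    (nth [::] [:: [:: 0; 0; 0; 1]; [:: 0; 1; 0; - y]; [:: 0; 0; 1; x];
                  [:: 1; - y; x; x ^+ 2 + y ^+ 2]] i)`_j.
suff /mulmx1_unit[] : osc_metric p *m g' = 1%:M by [].
apply/matrixP => -[[|[|[|[|//]]]] ?] [[|[|[|[|//]]]] ?];
  by rewrite !mxE !big_ord_recl big_ord0 !mxE /= /x /y; ring.
Qed.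

Lemma sum4 (V : nmodType) (F : 'I_4 -> V) : \sum_(i < 4) F i =
  F (@Ordinal 4 0 isT) + F (@Ordinal 4 1 isT)
  + F (@Ordinal 4 2 isT) + F (@Ordinal 4 3 isT).
Proof.
rewrite !big_ord_recl big_ord0 addr0 !addrA.
by congr (F _ + F _ + F _ + F _); apply: val_inj.
Qed.

(** Multiplying by the invertible metric lowers the index and removes [invmx] from the equation.
    What remains says that the planar velocity rotates with angular speed [osc_t X], t is affine,
    and z is driven by the planar motion. *)
Lemma geodesic_eqP p X Z :
  (forall k : 'I_4, Z ord0 k + \sum_(i < 4) \sum_(j < 4)
     christoffel k i j p * X ord0 i * X ord0 j = 0) <->
  [/\ osc_t Z = 0, osc_x Z = - (osc_t X * osc_y X),
      osc_y Z = osc_t X * osc_x X &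
      osc_z Z + 2^-1 * (osc_y p * osc_x Z - osc_x p * osc_y Z) = 0].
Proof.
(* [E] holds the Christoffel symbols of the first kind, contracted twice with [X]. *)
pose E : 'cV[R]_4 := \col_l (2^-1 * \sum_(i < 4) \sum_(j < 4)
  (dmetric (delta_mx ord0 i) j l + dmetric (delta_mx ord0 j) i l
   - dmetric (delta_mx ord0 l) i j) * X ord0 i * X ord0 j).
have chrE (k : 'I_4) : \sum_(i < 4) \sum_(j < 4)
     christoffel k i j p * X ord0 i * X ord0 j =
     (invmx (osc_metric p) *m E) k ord0.
  rewrite mxE; under [RHS]eq_bigr do rewrite mxE mulr_sumr mulr_sumr.
  rewrite [RHS]exchange_big; apply: eq_bigr => i _ /=.
  under [RHS]eq_bigr do rewrite mulr_sumr mulr_sumr.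
  rewrite [RHS]exchange_big; apply: eq_bigr => j _ /=.
  rewrite /christoffel mulr_sumr !mulr_suml; apply: eq_bigr => l _.
  by rewrite !pderiv_metric; ring.
have -> : (forall k : 'I_4, Z ord0 k + \sum_(i < 4) \sum_(j < 4)
     christoffel k i j p * X ord0 i * X ord0 j = 0) <->
    (forall l : 'I_4, (osc_metric p *m Z^T + E) l ord0 = 0).
  have col0 (M : 'cV[R]_4) : (forall l, M l ord0 = 0) <-> M = 0.
    split=> [M0|-> l]; last by rewrite mxE.
    by apply/colP => l; rewrite M0 mxE.
  rewrite col0; transitivity (Z^T + invmx (osc_metric p) *m E = 0).
    rewrite -col0; split=> h l; move: (h l); rewrite chrE !mxE //.
  split=> [h|h].
  - have := congr1 (mulmx (osc_metric p)) h.
    by rewrite mulmxDr mulmx0 mulKVmx// osc_metric_unit.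
  - have := congr1 (mulmx (invmx (osc_metric p))) h.
    by rewrite mulmxDr mulmx0 mulKmx// osc_metric_unit.
have EE : [/\ E (@Ordinal 4 0 isT) ord0 = 0,
  E (@Ordinal 4 1 isT) ord0 = osc_t X * osc_y X,
  E (@Ordinal 4 2 isT) ord0 = - (osc_t X * osc_x X) &
  E (@Ordinal 4 3 isT) ord0 = 0].
  by split; rewrite /E mxE !sum4 !mxE /= /osc_t /osc_x /osc_y !mxE /=; field.
rewrite -/E; move: E EE {chrE} => E [E0 E1 E2 E3].
have ev (l : 'I_4) : (osc_metric p *m Z^T + E) l ord0 =
    osc_metric p l (@Ordinal 4 0 isT) * osc_t Z
    + osc_metric p l (@Ordinal 4 1 isT) * osc_x Z
    + osc_metric p l (@Ordinal 4 2 isT) * osc_y Z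
    + osc_metric p l (@Ordinal 4 3 isT) * osc_z Z + E l ord0.
  by rewrite mxE; congr (_ + _); rewrite mxE sum4;
    congr (_ * _ + _ * _ + _ * _ + _ * _); exact: mxE.
split=> [h|[Zt Zx Zy Zz] l].
- move: (h (@Ordinal 4 0 isT)) (h (@Ordinal 4 1 isT))
    (h (@Ordinal 4 2 isT)) (h (@Ordinal 4 3 isT)).
  rewrite !ev E0 E1 E2 E3 !mxE /= => h0 h1 h2 h3.
  have Zt : osc_t Z = 0 by lra.
  rewrite Zt in h0 h1 h2 *; split=> //; lra.
- rewrite ev; move: l => [[|[|[|[|//]]]] li].
  + rewrite (_ : Ordinal li = @Ordinal 4 0 isT); last exact: val_inj.
    by rewrite E0 !mxE /= Zt; lra.
  + rewrite (_ : Ordinal li = @Ordinal 4 1 isT); last exact: val_inj.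
    by rewrite E1 !mxE /= Zt Zx; lra.
  + rewrite (_ : Ordinal li = @Ordinal 4 2 isT); last exact: val_inj.
    by rewrite E2 !mxE /= Zt Zy; lra.
  + rewrite (_ : Ordinal li = @Ordinal 4 3 isT); last exact: val_inj.
    by rewrite E3 !mxE /= Zt; lra.
Qed.
End GeodesicEquation.

(** * Geodesics of the group have constant left velocity *)

Section GeodesicFlow.
Context {R : realType}.
Implicit Types (a : R -> 'rV[R]_4) (p X xi : 'rV[R]_4) (s u : R).

Lemma is_derive_coord a u (j : 'I_4) : derivable a u 1 ->
  is_derive u (1 : R) (fun v => a v ord0 j) (derive1 a u ord0 j).
Proof.
move=> da; have := derivable_mxP a u 1 => -[/(_ da) /(_ ord0 j) daj _].
by apply: DeriveDef => //; rewrite derive1E derive_mx// mxE.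
Qed.

(** The factor of [2 * osc_t X] is the z-component of the left-invariant velocity, so the norm takes
    its value at the identity. *)
Lemma metric_atE p X : metric_at p X X =
  2 * osc_t X * (osc_z X + 2^-1 * (osc_y p * osc_x X - osc_x p * osc_y X))
  + osc_x X ^+ 2 + osc_y X ^+ 2.
Proof.
rewrite /metric_at mxE sum4.
rewrite !mxE !sum4 !mxE /= /osc_t /osc_x /osc_y /osc_z.
by field.
Qed.

Lemma geodesic_flow a s : (\forall u \near s, geodesic_at a u) ->
  exists xi, [/\ \forall u \near s, left_velocity a xi u &
    metric_at (a s) (derive1 a s) (derive1 a s) =
      2 * osc_t xi * osc_z xi + osc_x xi ^+ 2 + osc_y xi ^+ 2].
Proof.
move=> /nbhs_ballP[e /= e0 ga].
have {}ga u : `|u - s| < e -> geodesic_at a u.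
  by move=> us; apply: ga; rewrite /ball /= distrC.
pose t u := osc_t (a u); pose x u := osc_x (a u).
pose y u := osc_y (a u); pose z u := osc_z (a u).
pose t1 u := osc_t (derive1 a u); pose x1 u := osc_x (derive1 a u).
pose y1 u := osc_y (derive1 a u); pose z1 u := osc_z (derive1 a u).
(* With [t1], the functions [al], [be] and [ga'] are the components of [a^-1 a']. Turning the planar
   velocity back by the angle t cancels the rotation imposed by the geodesic equation. *)
pose al u := cos (t u) * x1 u + sin (t u) * y1 u.
pose be u := cos (t u) * y1 u - sin (t u) * x1 u.
pose ga' u := z1 u - 2^-1 * (x u * y1 u - y u * x1 u).
have d1 u : `|u - s| < e -> [/\ is_derive u (1 : R) t (t1 u),
    is_derive u (1 : R) x (x1 u),
    is_derive u (1 : R) y (y1 u) & is_derive u (1 : R) z (z1 u)].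
  by move=> /ga[da _ _]; split; exact: is_derive_coord.
have d2 u : `|u - s| < e -> [/\ is_derive u (1 : R) t1 0,
    is_derive u (1 : R) al 0,
    is_derive u (1 : R) be 0 & is_derive u (1 : R) ga' 0].
  move=> ue; have [dt dx dy dz] := d1 _ ue.
  have [_ da' /geodesic_eqP[Zt Zx Zy Zz]] := ga _ ue.
  have dt1 : is_derive u (1 : R) t1 0 by rewrite -Zt; exact: is_derive_coord.
  have dx1 : is_derive u (1 : R) x1 (- (t1 u * y1 u)).
    by rewrite -Zx; exact: is_derive_coord.
  have dy1 : is_derive u (1 : R) y1 (t1 u * x1 u).
    by rewrite -Zy; exact: is_derive_coord.
  have dz1 : is_derive u (1 : R) z1 (2^-1 * t1 u * (x u * x1 u + y u * y1 u)).
    suff <- : osc_z (derive1 (derive1 a) u) =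
        2^-1 * t1 u * (x u * x1 u + y u * y1 u).
      exact: is_derive_coord.
    move: Zz; rewrite Zx Zy -/(x u) -/(y u) -/(t1 u) -/(x1 u) -/(y1 u) => Zz.
    by apply/eqP; rewrite -subr_eq0 -[X in _ == X]Zz; apply/eqP; ring.
  split=> //; apply: is_derive_eq; rewrite /GRing.scale /=; first by ring.
  - by ring.
  - by field.
have c1 : [/\ forall u, `|u - s| < e -> t1 u = t1 s,
    forall u, `|u - s| < e -> al u = al s,
    forall u, `|u - s| < e -> be u = be s &
    forall u, `|u - s| < e -> ga' u = ga' s].
  by split=> u ue; [apply: (@derive_eq_ball _ t1 (cst (t1 s)) (cst 0) s e) |
    apply: (@derive_eq_ball _ al (cst (al s)) (cst 0) s e) |
    apply: (@derive_eq_ball _ be (cst (be s)) (cst 0) s e) |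
    apply: (@derive_eq_ball _ ga' (cst (ga' s)) (cst 0) s e)] => // v /d2[].
have [ct cal cbe cga] := c1.
exists (vec4 (t1 s) (al s) (be s) (ga' s)).
split; last first.
  rewrite metric_atE !vec4E /al /be /ga'.
  rewrite -/(x s) -/(y s) -/(t1 s) -/(x1 s) -/(y1 s) -/(z1 s).
  have h := sin2cos2 (t s).
  by field: h.
apply/nbhs_ballP; exists e => //= u; rewrite /ball /= distrC => ue.
rewrite /left_velocity !vec4E -(ct _ ue) -(cal _ ue) -(cbe _ ue) -(cga _ ue).
rewrite -/(t u) -/(x u) -/(y u).
have [dt dx dy dz] := d1 _ ue.
have h := sin2cos2 (t u).
split=> //.
- rewrite (_ : _ - _ = x1 u) //.
  by rewrite /al /be; ring: h.
- rewrite (_ : _ + _ = y1 u) //.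
  by rewrite /al /be; ring: h.
- rewrite (_ : _ + _ = z1 u) //.
  by rewrite /al /be /ga'; field: h.
Qed.

End GeodesicFlow.

(** * Explicit null flows and their periods *)

Section NullFlow.
Context {R : realType} (k : nat) (i : lattice_index) (hk : (1 <= k)%N).
Implicit Types (A : R -> 'rV[R]_4) (p xi : 'rV[R]_4) (s u : R).

Lemma left_velocity_vec4 (t x y z : R -> R) xi u :
  is_derive u (1 : R) t (osc_t xi) ->
  is_derive u (1 : R) x (cos (t u) * osc_x xi - sin (t u) * osc_y xi) ->
  is_derive u (1 : R) y (sin (t u) * osc_x xi + cos (t u) * osc_y xi) ->
  is_derive u (1 : R) z (osc_z xi + 2^-1 *
    (x u * (sin (t u) * osc_x xi + cos (t u) * osc_y xi)
     - y u * (cos (t u) * osc_x xi - sin (t u) * osc_y xi))) ->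
  left_velocity (fun v => vec4 (t v) (x v) (y v) (z v)) xi u.
Proof.
have [et ex ey ez] : [/\ osc_t \o (fun v => vec4 (t v) (x v) (y v) (z v)) = t,
    osc_x \o (fun v => vec4 (t v) (x v) (y v) (z v)) = x,
    osc_y \o (fun v => vec4 (t v) (x v) (y v) (z v)) = y &
    osc_z \o (fun v => vec4 (t v) (x v) (y v) (z v)) = z].
  by split; apply: funext => v /=; rewrite vec4E.
rewrite /left_velocity et ex ey ez.
by rewrite !vec4E.
Qed.

Lemma osc_mul_central (t z : R) p : cos t = 1 -> sin t = 0 ->
  osc_mul p (vec4 t 0 0 z) =
    vec4 (osc_t p + t) (osc_x p) (osc_y p) (osc_z p + z).
Proof.
move=> ct st; by apply: rV4P; rewrite osc_mulE !vec4E ?ct ?st; ring.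
Qed.

(** The element [(2 pi m, 0, 0, c)] lies in each of the three lattices, since every step divides
    [2 * pi], and multiplying by it on the right only shifts t and z. *)
Lemma proj_central (m c : int) p :
  Defs.proj k i (vec4 (osc_t p + m%:~R * (2 * pi))
    (osc_x p) (osc_y p) (osc_z p + c%:~R))
  = Defs.proj k i p.
Proof.
have cs (n : int) :
    cos (n%:~R * (2 * pi)) = 1 :> R /\ sin (n%:~R * (2 * pi)) = 0 :> R.
  have nc (n' : nat) :
      cos (n'%:R * (2 * pi)) = 1 :> R /\ sin (n'%:R * (2 * pi)) = 0 :> R.
    elim: n' => [|n' [IHc IHs]]; first by rewrite mul0r cos0 sin0.
    rewrite -natr1 mulrDl mul1r cosD sinD IHc IHs.
    rewrite (_ : 2 * pi = pi *+ 2) ?cos2pi ?sin2pi; last by rewrite mulr_natl.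
    by split; ring.
  case: n => n; first exact: nc.
  by rewrite NegzE !rmorphN /= mulNr cosN sinN;
    have [-> ->] := nc n.+1; rewrite oppr0.
have step n : exists n' : int, n%:~R * (2 * pi) = n'%:~R * lattice_step R i.
  by case: i; [exists n|exists (n * 2)|exists (n * 4)];
    rewrite /= ?intrM; field.
have inL (n d : int) :
    Lambda k i (vec4 (n%:~R * (2 * pi)) 0 0 d%:~R : 'rV[R]_4).
  exact: Lambda_tz.
have [cm sm] := cs m; have [cNm sNm] := cs (- m).
apply: (eq_proj hk (inL m c) (inL (- m) (- c)));
  rewrite osc_mul_central// !vec4E.
by rewrite !rmorphN /= mulNr !addrK -vec4_eta.
Qed.

Lemma null_flow p xi s :
  2 * osc_t xi * osc_z xi + osc_x xi ^+ 2 + osc_y xi ^+ 2 = 0 ->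
  exists A, [/\ A s = p, forall u, left_velocity A xi u &
    (forall u, A u = p) \/ (exists2 T, T != 0 &
      forall u, Defs.proj k i (A (u + T)) = Defs.proj k i (A u))].
Proof.
move=> null; have [t0|t0] := eqVneq (osc_t xi) 0.
  have [x0 y0] : osc_x xi = 0 /\ osc_y xi = 0.
    move: null; rewrite t0 mulr0 mul0r add0r => /eqP.
    by rewrite paddr_eq0 ?sqr_ge0// !sqrf_eq0 => /andP[/eqP-> /eqP->].
  exists (fun u => vec4 (osc_t p) (osc_x p) (osc_y p)
    (osc_z p + (u - s) * osc_z xi)).
  split.
  - by rewrite subrr mul0r addr0 -vec4_eta.
  - move=> u; apply: (@left_velocity_vec4 (cst (osc_t p)) (cst (osc_x p))
      (cst (osc_y p))
      (fun u => osc_z p + (u - s) * osc_z xi)).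
    + by rewrite t0; exact: is_derive_cst.
    + by rewrite x0 y0 !mulr0 subr0; exact: is_derive_cst.
    + by rewrite x0 y0 !mulr0 addr0; exact: is_derive_cst.
    + by rewrite x0 y0; apply: is_derive_eq; rewrite /GRing.scale /=; ring.
  have [z0|z0] := eqVneq (osc_z xi) 0.
    by left=> u; rewrite z0 mulr0 addr0 -vec4_eta.
  (* In this time z grows by exactly 1, a lattice translation. *)
  right; exists (osc_z xi)^-1; first by rewrite invr_eq0.
  move=> u; set q := vec4 _ _ _ (_ + (u - s) * _).
  rewrite -[RHS](proj_central 0 1); congr (Defs.proj k i _).
rewrite !vec4E.
  by rewrite mul0r addr0; congr vec4; field.
(* The vector [w] is chosen so that [R(th) w] is a primitive of the planar velocity
   [R(th) (osc_x xi, osc_y xi)]: the planar motion is a circle about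
   [(osc_x p - X s, osc_y p - Y s)]. *)
pose wx := osc_y xi / osc_t xi; pose wy := - (osc_x xi / osc_t xi).
pose th u := osc_t p + (u - s) * osc_t xi.
pose X u := cos (th u) * wx - sin (th u) * wy.
pose Y u := sin (th u) * wx + cos (th u) * wy.
(* Nullity gives exactly the value cancelling the constant rate of z that comes from the circular
   motion. Only the cross product of the centre with the displacement along the circle is left in
   z. *)
have zE : osc_z xi = - (osc_x xi ^+ 2 + osc_y xi ^+ 2) / (2 * osc_t xi).
  apply: (mulfI (x := 2 * osc_t xi)); first by rewrite mulf_neq0.
  by rewrite [RHS]mulrC divfK ?mulf_neq0//; lra.
exists (fun u => vec4 (th u) (osc_x p + X u - X s) (osc_y p + Y u - Y s)
  (osc_z p + 2^-1 *
    ((osc_x p - X s) * (Y u - Y s) - (osc_y p - Y s) * (X u - X s)))).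
have dth u : is_derive u (1 : R) th (osc_t xi).
  by apply: is_derive_eq; rewrite /GRing.scale /=; ring.
have dX u : is_derive u (1 : R) X
    (cos (th u) * osc_x xi - sin (th u) * osc_y xi).
  by apply: is_derive_eq; rewrite /GRing.scale /= /wx /wy; field.
have dY u : is_derive u (1 : R) Y
    (sin (th u) * osc_x xi + cos (th u) * osc_y xi).
  by apply: is_derive_eq; rewrite /GRing.scale /= /wx /wy; field.
split.
- have ths : th s = osc_t p by rewrite /th subrr mul0r addr0.
  by rewrite ths !addrK !subrr !mulr0 subrr mulr0 addr0 -vec4_eta.
- move=> u; apply: (@left_velocity_vec4 th (fun u => osc_x p + X u - X s)
    (fun u => osc_y p + Y u - Y s) (fun u => osc_z p + 2^-1 *
    ((osc_x p - X s) * (Y u - Y s) - (osc_y p - Y s) * (X u - X s)))) => //.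
  + by apply: is_derive_eq; ring.
  + by apply: is_derive_eq; ring.
  + apply: is_derive_eq; rewrite zE /GRing.scale /= /X /Y /wx /wy.
    have h := sin2cos2 (th u).
    by field: h.
(* One full turn: [X] and [Y] return, so x, y and z do too, and t shifts by [2 * pi]. *)
right; exists (2 * pi / osc_t xi).
  by rewrite !mulf_neq0 ?invr_eq0// gt_eqF// pi_gt0.
move=> u; set q := (X in _ = Defs.proj k i X).
rewrite -[RHS](proj_central 1 0); congr (Defs.proj k i _).
rewrite !vec4E.
have thT : th (u + 2 * pi / osc_t xi) = th u + pi *+ 2.
  by rewrite /th -mulr_natl; field.
have XT : X (u + 2 * pi / osc_t xi) = X u by rewrite /X thT cosD2pi sinD2pi.
have YT : Y (u + 2 * pi / osc_t xi) = Y u by rewrite /Y thT cosD2pi sinD2pi.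
by rewrite XT YT thT addr0 mul1r mulr_natl.
Qed.

End NullFlow.

(** * Periodicity of null geodesics in the quotient *)

Section NullGeodesics.
Context {R : realType} (k : nat) (i : lattice_index) (hk : (1 <= k)%N).
Implicit Types (c : R -> solvmanifold R k i).

Lemma null_geodesic_periodic c : null_geodesic c -> periodic_curve c.
Proof.
move=> [_ [s [u csu]] null].
have flow v : exists A xi, [/\ forall w, left_velocity A xi w,
    \forall w \near v, c w = Defs.proj k i (A w) &
    (forall w, A w = A v) \/ (exists2 T, T != 0 &
      forall w, Defs.proj k i (A (w + T)) = Defs.proj k i (A w))].
  have [a ca a0] := null v.
  have [|xi [da xi0]] := @geodesic_flow R a v.
    by apply: filterS ca => w [].
  rewrite a0 in xi0.
  have [A [Av dA AT]] := null_flow i hk (a v) v (esym xi0).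
  exists A, xi; split=> //; last by case: AT; [left=> w; rewrite Av|right].
  move/nbhs_ballP : da => [e /= e0 da].
  (* The local lift and the explicit flow share the velocity [xi] and the point [a v], so the flow
     extends the lift to all parameters. *)
  have aA w : `|w - v| < e -> a w = A w.
    apply: (@left_velocity_unique R a A xi v e) => // w' we.
    by apply: da; rewrite /ball /= distrC.
  near=> w; rewrite -aA.
    by have [] : c w = Defs.proj k i (a w) /\ geodesic_at a w by near: w.
  rewrite distrC; near: w; exact: nbhsx_ballx.
have [A [xi [dA cA AT]]] := flow 0.
have {}cA w : c w = Defs.proj k i (A w).
  apply: (flow_continuation hk _ dA cA) => v.
  by have [B [eta [dB cB _]]] := flow v; exists B, eta.
case: AT => [Acst|[T T0 AT]]; first by case: csu; rewrite !cA !Acst.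
by exists T; split=> [|w]; [exact/eqP|rewrite !cA].
Unshelve. all: by end_near. Qed.

End NullGeodesics.

(** * The lines through the identity in the plane of t and z *)

Section AxialGeodesics.
Context {R : realType} (k : nat) (i : lattice_index) (hk : (1 <= k)%N).
Implicit Types (K : R).

Definition axial K (s : R) : 'rV[R]_4 := s *: vec4 1 0 0 K.

Lemma axial_vec4 K s : axial K s = vec4 s 0 0 (s * K).
Proof.
apply: rV4P; rewrite vec4E /axial /vec4 /osc_t /osc_x /osc_y /osc_z !mxE /=;
  by rewrite ?mulr1 ?mulr0.
Qed.

Lemma derivable_axial K s : derivable (axial K) s 1.
Proof.
apply/derivable_mxP => j l.
rewrite (_ : (fun _ => _) = fun x => x * vec4 1 0 0 K j l).
  exact: ex_derive.
by apply: funext => x; rewrite mxE.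
Qed.

Lemma derive1_axial K : derive1 (axial K) = cst (vec4 1 0 0 K).
Proof.
apply: funext => s; apply/rowP => j.
rewrite derive1E derive_mx ?mxE; last exact: derivable_axial.
rewrite (_ : (fun _ => _) = fun x => x * vec4 1 0 0 K ord0 j); last first.
  by apply: funext => x; rewrite [LHS]mxE.
rewrite (_ : _`_j = vec4 1 0 0 K ord0 j); last by rewrite mxE.
by apply: derive_val; apply: is_derive_eq; rewrite /GRing.scale /=; ring.
Qed.

Lemma axial_geodesic_at K s : geodesic_at (axial K) s.
Proof.
split; first exact: derivable_axial.
  by rewrite derive1_axial; exact: derivable_cst.
apply/geodesic_eqP; rewrite derive1_axial derive1_cst.
rewrite axial_vec4 !vec4E /osc_t /osc_x /osc_y /osc_z !mxE.
by split; ring.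
Qed.

Lemma axial_lift K s :
  geodesic_lift (fun u => Defs.proj k i (axial K u)) s (axial K).
Proof.
by rewrite /geodesic_lift; near=> u; split=> //; exact: axial_geodesic_at.
Unshelve. all: by end_near. Qed.

Lemma axial_speed K s :
  metric_at (axial K s) (derive1 (axial K) s) (derive1 (axial K) s) = 2 * K.
Proof. by rewrite metric_atE derive1_axial axial_vec4 /= !vec4E; ring. Qed.

(** All three lattice steps are integer multiples of [pi / 2], so one necessary condition serves
    every index. On the line x = y = 0, hence the cocycle vanishes and z is additive. *)
Lemma proj_axial_eq K s u :
  Defs.proj k i (axial K s) = Defs.proj k i (axial K u) ->
  (exists m : int, s - u = m%:~R * (pi / 2)) /\
  (exists c : int, (s - u) * K = c%:~R / (2 * k%:R)).
Proof.
move=> /proj_eqP[l [[m tl] [_ [_ [c [_ _ zl]]]]] E].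
have [n stepE] := @lattice_step_pihalf R i.
have := congr1 osc_t E; have := congr1 osc_z E.
rewrite osc_mul_z osc_mul_t !axial_vec4 !vec4E => Ez Et; split.
- exists (m * n); rewrite Et tl stepE intrM; ring.
- by exists c; rewrite -zl mulrBl Ez; ring.
Qed.

Lemma int_mul_pi_irrational (m c : int) (d : nat) : m != 0 -> d != 0 ->
  m%:~R * pi <> c%:~R / d%:R :> R.
Proof.
move=> m0 d0 E; apply: (@pi_irrationnal R);
exists (c%:~R / (m%:~R * d%:R)) => //.
rewrite fmorph_div rmorphM /= !ratr_int ratr_nat.
rewrite -[RHS](mulKf (x := m%:~R)) ?intr_eq0// E.
by field; rewrite intr_eq0 pnatr_eq0 m0 d0.
Qed.

Lemma axial_nonconstant K : nonconstant (fun u => Defs.proj k i (axial K u)).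
Proof.
(* Equal images of the parameters 1 and 0 would give [1 = m * pi / 2]. *)
exists 1, 0 => /proj_axial_eq[[m]]; rewrite subr0 => mE _.
have m0 : m != 0.
  by apply: contraPneq mE => ->; rewrite mul0r; exact/eqP/oner_neq0.
apply: (@int_mul_pi_irrational m 2 1) => //.
transitivity (2 * (m%:~R * (pi / 2)) : R); first by field.
by rewrite -mE; field.
Qed.

Lemma axial_not_closed K : K != 0 -> (exists n : int, K = n%:~R) ->
  ~ closed_curve (fun u => Defs.proj k i (axial K u)).
Proof.
move=> K0 [n nE] [s [u [su /proj_axial_eq[[m sum] [c sKc]]]]].
rewrite sum nE in sKc.
have m0 : m != 0.
  by apply/eqP => m0; apply: su; apply/eqP; rewrite -subr_eq0 sum m0 mul0r.
have n0 : n != 0 by rewrite nE intr_eq0 in K0.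
(* Eliminating [s - u] from the t and z conditions yields [m * n * pi = c / k] with [m * n]
   nonzero. *)
apply: (@int_mul_pi_irrational (m * n) c k); rewrite ?mulf_neq0 -?lt0n//.
rewrite intrM; transitivity (2 * (m%:~R * (pi / 2) * n%:~R) : R).
  by field.
by rewrite sKc; field; rewrite pnatr_eq0 -lt0n.
Qed.

Lemma axial_closed (n : int) :
  closed_curve (fun u => Defs.proj k i (axial (n%:~R / (2 * pi)) u)).
Proof.
have p0 : pi != 0 :> R by rewrite gt_eqF// pi_gt0.
(* At time [2 * pi] the line is at [(2 pi, 0, 0, n)], a point of the lattice. *)
exists (2 * pi), 0; split; first by apply/eqP; rewrite mulf_neq0.
rewrite !axial_vec4 -[RHS](proj_central i hk 1 n) !vec4E.
by congr (Defs.proj k i (vec4 _ _ _ _)); move: pi p0 => P P0; field.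
Qed.

Lemma axial_timelike K : K < 0 ->
  timelike_geodesic (fun u => Defs.proj k i (axial K u)).
Proof.
move=> K0; split; [|exact: axial_nonconstant|]=> s; exists (axial K);
  try exact: axial_lift.
by rewrite axial_speed pmulr_rlt0.
Qed.

Lemma axial_spacelike K : 0 < K ->
  spacelike_geodesic (fun u => Defs.proj k i (axial K u)).
Proof.
move=> K0; split; [|exact: axial_nonconstant|]=> s; exists (axial K);
  try exact: axial_lift.
by rewrite axial_speed pmulr_rgt0.
Qed.

End AxialGeodesics.

Theorem theorem4p11 (R : realType) (k : nat) (hk : (1 <= k)%N)
    (i : lattice_index) :
  (forall c : R -> solvmanifold R k i, null_geodesic c -> periodic_curve c) /\
  [/\ exists c : R -> solvmanifold R k i,
        timelike_geodesic c /\ closed_curve c,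
      exists c : R -> solvmanifold R k i,
        timelike_geodesic c /\ ~ closed_curve c,
      exists c : R -> solvmanifold R k i,
        spacelike_geodesic c /\ closed_curve c &
      exists c : R -> solvmanifold R k i,
        spacelike_geodesic c /\ ~ closed_curve c].
Proof.
have pi20 : 0 < 2 * pi :> R by rewrite mulr_gt0 ?pi_gt0.
split; first by move=> c; exact: null_geodesic_periodic.
split.
- exists (fun u => Defs.proj k i (axial ((-1)%:~R / (2 * pi)) u)).
  split; last exact: axial_closed.
  by apply: axial_timelike; rewrite rmorphN mulN1r oppr_lt0 invr_gt0.
- exists (fun u => Defs.proj k i (axial (-1) u)).
  split; first by apply: axial_timelike; rewrite oppr_lt0.
  by apply: axial_not_closed; rewrite ?oppr_eq0 ?oner_neq0//;
    exists (-1); rewrite rmorphN.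
- exists (fun u => Defs.proj k i (axial (1%:~R / (2 * pi)) u)).
  split; last exact: axial_closed.
  by apply: axial_spacelike; rewrite divr_gt0.
- exists (fun u => Defs.proj k i (axial 1 u)).
  split; first by apply: axial_spacelike.
  by apply: axial_not_closed; rewrite ?oner_neq0//; exists 1.
Qed.
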